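(* Let $(F_n)_\phi$ be any signed fan graph with sink given by the universal vertex (the vertex of degree $n$ joined to all vertices of the path). Then for $n\ge1$ we have $\mathcal{K}((F_n)_\phi)\cong\mathbb{Z}_{f_{2n}}$.
   Context: A signed graph $G_\phi$ is a finite simple graph $G=(V,E)$ with a sign function $\phi:E\to\{+,-\}$. The fan graph $F_n$ is obtained from a path graph on $n$ vertices $v_1,\dots,v_n$ by adding a vertex $q$ adjacent to all of them (so $F_1$ is a single edge and $F_2$ is a triangle); $q$ is the sink. The reduced signed Laplacian $L$ of $(F_n)_\phi$ is the $n\times n$ matrix with $L_{ii}=\deg_{F_n}(v_i)$ (counting the edge to $q$) and, for $i\ne j$, $L_{ij}=-1$ if $v_iv_j$ is a positive edge, $+1$ if it is a negative edge, $0$ if it is not an edge. The critical group is $\mathcal{K}((F_n)_\phi)=\mathbb{Z}^n/\mathrm{im}\,L$. $f_k$ is the $k$th Fibonacci number ($f_0=0$, $f_1=1$, $f_k=f_{k-1}+f_{k-2}$), and $\mathbb{Z}_k$ denotes $\mathbb{Z}/k\mathbb{Z}$. *)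

(* Defs.v *)
From HB Require Import structures.
From mathcomp Require Import all_boot all_order all_algebra.
From mathcomp Require Import ring_quotient boolp.

Set Implicit Arguments.
Unset Strict Implicit.
Unset Printing Implicit Defensive.

Import GRing.Theory.
Local Open Scope ring_scope.

Record sgraph (V : finType) := SGraph {
  adj : rel V;
  adj_sym : symmetric adj;
  adj_irrefl : irreflexive adj
}.

Section Graphs.
Variable V : finType.

Definition edge_set (G : sgraph V) : {set {set V}} :=
  [set e | [exists v, exists w, adj G v w && (e == [set v; w])]].

Definition edge (G : sgraph V) : Type := {e : {set V} | e \in edge_set G}.

Definition degree (G : sgraph V) (v : V) : nat := #|[set w | adj G v w]|.

Variant sign := Plus | Minus.

Record signed_graph := SignedGraph {
  ugraph : sgraph V;
  sign_of : edge ugraph -> sign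
}.

(* [insub] returns [Some e] exactly when the pair [set v; w] is an edge. *)
Definition laplacian_entry (S : signed_graph) (v w : V) : int :=
  if v == w then (degree (ugraph S) v)%:Z
  else match insub [set v; w] : option (edge (ugraph S)) with
       | Some e => match sign_of e with Plus => -1 | Minus => 1 end
       | None => 0
       end.

End Graphs.

(* On vertex set [option 'I_n] the sink is [None]; its row and column are
   removed, but the edges to it still count in the degrees. *)
Definition reduced_laplacian (n : nat) (S : signed_graph (option 'I_n)) :
    'M[int]_n :=
  \matrix_(i, j) laplacian_entry S (Some i) (Some j).

Section Cokernel.
Variables (m n : nat) (A : 'M[int]_(m, n)).

Definition im_mx : {pred 'cV[int]_m} :=
  fun v => `[< exists x : 'cV[int]_n, v = A *m x >].

Fact im_mx_zmod_closed : zmod_closed im_mx.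
Proof.
split; first by apply/asboolP; exists 0; rewrite mulmx0.
move=> _ _ /asboolP[x ->] /asboolP[y ->].
by apply/asboolP; exists (x - y); rewrite mulmxBr.
Qed.

HB.instance Definition _ :=
  GRing.isZmodClosed.Build 'cV[int]_m im_mx im_mx_zmod_closed.

Definition coker : zmodType := Quotient.quot im_mx.

End Cokernel.

Definition critical_group (n : nat) (S : signed_graph (option 'I_n)) :
    zmodType :=
  coker (reduced_laplacian S).

(* Not ['Z_k], which is Z/2 for k = 1: here [Zmod 1] is the trivial group. *)
Definition Zmod (k : nat) : zmodType := Quotient.quot (dvdz k%:Z : {pred int}).

Definition zmod_isog (A B : zmodType) : Prop :=
  exists f : {additive A -> B}, bijective f.

Section Fan.
Variable n : nat.

(* [Some i] is the path vertex v_(i+1), [None] is the universal vertex q. *)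
Definition fan_adj : rel (option 'I_n) := fun u v =>
  match u, v with
  | None, None => false
  | Some i, Some j => (i.+1 == j :> nat) || (j.+1 == i :> nat)
  | _, _ => true
  end.

Fact fan_adj_sym : symmetric fan_adj.
Proof. by case=> [i|] [j|] //=; rewrite orbC. Qed.

Fact fan_adj_irrefl : irreflexive fan_adj.
Proof. by case=> [i|] //=; rewrite orbb; apply: gtn_eqF. Qed.

Definition fan : sgraph (option 'I_n) := SGraph fan_adj_sym fan_adj_irrefl.

End Fan.

Fixpoint fib (k : nat) : nat :=
  match k with
  | 0 => 0%N
  | 1 => 1%N
  | (m.+1 as k').+1 => (fib k' + fib m)%N
  end.

(* Main.v *)
From HB Require Import structures.
Require Import Defs.
From mathcomp Require Import all_boot all_order all_algebra.
From mathcomp Require Import ring_quotient boolp zify ring.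

(** The edges of a path form no cycle, so its signs can be switched away: there
    is a sign vector s with L = D B D, where D = diag(s) and B is the reduced
    Laplacian of the all-positive fan ([fan_switching]).

    For B, consider a homomorphism from coker B to an abelian group U, that is,
    a sequence y of elements of U killed by every column of B.  Column j says
        y_j + (y_j - y_(j-1)) = y_(j+1) - y_j,
    without the difference on the left when j is the first vertex and with 0 on
    the right when j is the last.  This is the Fibonacci recurrence in disguise:
    if the y_k are the odd-indexed Fibonacci terms u f_(2k+1), counting from
    k = 0, then the two sides are the even-indexed terms u f_(2k+2) in between.
    Hence y is determined by u = y_0 ([fan_laplacian_kernel]), and all that is
    left is the last column, u f_(2n) = 0 ([fan_laplacian_fib]).

    Taking for U the cokernel of L itself, and for y the classes of the basis
    vectors corrected by s, shows that the class g of the first basis vector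
    generates the cokernel, that f_(2n) g = 0, and that the class of v is F(v) g
    with F(v) = sum_i s_i f_(2i+1) v_i ([fan_coker_cyclic]).  Taking for U the
    integers shows that F maps im L into f_(2n) Z ([fan_functional_column]).
    So F induces the isomorphism with Z / f_(2n) Z. *)

Set Implicit Arguments.
Unset Strict Implicit.
Unset Printing Implicit Defensive.

Import GRing.Theory.
Local Open Scope ring_scope.

(** [G] need not be additive: it only serves to invert the induced map. *)
Lemma quot_isog (A B : zmodType) (S : zmodClosed A) (T : zmodClosed B)
    (F : {additive A -> B}) (G : B -> A) :
  cancel G F -> (forall a, (F a \in T) = (a \in S)) ->
  zmod_isog (Quotient.quot S) (Quotient.quot T).
Proof.
move=> GK FS.
pose f (x : Quotient.quot S) := \pi_(Quotient.quot T)%qT (F (repr x)).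
have fpi a : f (\pi_(Quotient.quot S)%qT a) = \pi_(Quotient.quot T)%qT (F a).
  apply/eqP; rewrite -Quotient.idealrBE -raddfB FS Quotient.idealrBE.
  by rewrite reprK.
have f_add : zmod_morphism f.
  move=> x y; rewrite -[x]reprK -[y]reprK -[_ - _]raddfB !fpi.
  by rewrite !raddfB.
pose fM := GRing.isZmodMorphism.Build _ _ f f_add.
pose fA : {additive Quotient.quot S -> Quotient.quot T} :=
  HB.pack f fM.
exists fA, (fun y => \pi_(Quotient.quot S)%qT (G (repr y))) => [x|y] /=.
  rewrite -[x]reprK fpi; apply/eqP; rewrite -Quotient.idealrBE -FS raddfB GK.
  by rewrite Quotient.idealrBE reprK.
by rewrite fpi GK reprK.
Qed.

Definition fan_laplacian n : 'M[int]_n :=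
  \matrix_(i, j) ((1 + (0 < i) + (i.+1 < n))%N%:Z *+ (i == j)
                  - (i.+1 == j :> nat)%:Z - (j.+1 == i :> nat)%:Z).

(** [fib (2 * k.+1)] does not reduce to a sum on its own, since [muln] does not
    simplify; these lemmas move every index to [2 * k] and its successors. *)
Lemma fib_even k : fib (2 * k).+2 = (fib (2 * k).+1 + fib (2 * k))%N.
Proof. by []. Qed.

Lemma fib_double_succ k : fib (2 * k.+1) = fib (2 * k).+2.
Proof. by rewrite mulnS. Qed.

Lemma fib_odd k : fib (2 * k.+1).+1 = (fib (2 * k).+2 + fib (2 * k).+1)%N.
Proof. by rewrite mulnS. Qed.

Definition fib_step := (fib_double_succ, fib_odd, fib_even).

(** Grouping the degree 1 + [0 < j] + [j + 1 < n] with the neighbours turns a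
    column into a difference of consecutive slopes, the form in which the
    Fibonacci recurrence is visible.  At the two ends of the path the missing
    neighbour is removed by a factor 0. *)
Lemma fan_laplacian_column (U : zmodType) n (y : nat -> U) (j : 'I_n) :
  \sum_(i < n) y i *~ fan_laplacian n i j =
    y j + (y j - y j.-1) *+ (0 < j)%N - (y j.+1 - y j) *+ (j.+1 < n)%N.
Proof.
under eq_bigr => i _ do rewrite mxE !mulrzBr.
rewrite !sumrB.
have -> : \sum_(i < n) y i *~ ((1 + (0 < i) + (i.+1 < n))%N%:Z *+ (i == j)) =
          y j *+ (1 + (0 < j) + (j.+1 < n))%N.
  rewrite (bigD1 j) //= eqxx mulr1n -pmulrn big1 ?addr0 // => i /negPf->.
  by rewrite mulr0n mulr0z.
have -> : \sum_(i < n) y i *~ (i.+1 == j :> nat)%:Z = y j.-1 *+ (0 < j)%N.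
  under eq_bigr => i _ do rewrite -pmulrn mulrb.
  case: j => [[|j] lt_jn] /=; first by rewrite big1.
  by rewrite -big_mkcond (big_ord1_eq _ y) ltnW.
have -> : \sum_(i < n) y i *~ (j.+1 == i :> nat)%:Z = y j.+1 *+ (j.+1 < n)%N.
  under eq_bigr => i _ do rewrite -pmulrn mulrb eq_sym.
  by rewrite -big_mkcond (big_ord1_eq _ y) mulrb.
by rewrite !mulrnDr !mulrnBl opprB -!addrA; congr (_ + (_ + _)); rewrite addrCA.
Qed.

(** The sequence satisfies every column equation but the last because
    f_(2j+1) + (f_(2j+1) - f_(2j-1)) = f_(2j+2) = f_(2j+3) - f_(2j+1);
    at the last vertex the right-hand side is missing and f_(2n) remains. *)
Lemma fan_laplacian_fib (U : zmodType) n (u : U) (j : 'I_n) :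
  \sum_(i < n) (u *+ fib (2 * i).+1) *~ fan_laplacian n i j =
    if j.+1 == n then u *+ fib (2 * n) else 0.
Proof.
rewrite (fan_laplacian_column (fun i => u *+ fib (2 * i).+1)).
have -> : u *+ fib (2 * j).+1
    + (u *+ fib (2 * j).+1 - u *+ fib (2 * j.-1).+1) *+ (0 < j)%N =
    u *+ fib (2 * j).+2.
  case: (nat_of_ord j) => [|k]; first by rewrite addr0.
  rewrite mulr1n [k.+1.-1]/= -mulrnBr; last by rewrite !fib_step; lia.
  by rewrite -mulrnDr; congr (_ *+ _); rewrite !fib_step; lia.
have := ltn_ord j; rewrite leq_eqVlt; case: eqP => [jn _ | _ lt_jn].
  by rewrite ltn_neqAle jn eqxx subr0 -fib_double_succ jn.
rewrite (lt_jn : (j.+1 < n)%N) mulr1n -mulrnBr; last by rewrite !fib_step; lia.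
rewrite -mulrnBr; last by rewrite !fib_step; lia.
by rewrite !fib_step (_ : _ - _ = 0)%N //; lia.
Qed.

(** Each column but the last expresses [y j.+1] through earlier terms. *)
Lemma fan_laplacian_kernel (U : zmodType) n (y : nat -> U) :
  (forall j : 'I_n, \sum_(i < n) y i *~ fan_laplacian n i j = 0) ->
  forall k, (k < n)%N -> y k = y 0%N *+ fib (2 * k).+1.
Proof.
move=> y0 k; elim/ltn_ind: k => -[|k] IH lt_kn //.
have := y0 (Ordinal (ltnW lt_kn)).
rewrite fan_laplacian_column [nat_of_ord _]/=.
rewrite lt_kn mulr1n => /eqP; rewrite subr_eq0 eq_sym subr_eq => /eqP->.
rewrite (IH k (ltnSn k) (ltnW lt_kn)).
case: k IH lt_kn => [|k] IH lt_kn; first by rewrite addr0 -mulr2n.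
rewrite (IH k (ltnW (ltnSn _)) (ltnW (ltnW lt_kn))) mulr1n -mulrnBr; last first.
  by rewrite !fib_step; lia.
by rewrite -!mulrnDr; congr (_ *+ _); rewrite !fib_step; lia.
Qed.

(** An unordered pair remembers its ends, and [adj G] is symmetric; without loops
    the pair cannot degenerate to a singleton. *)
Lemma mem_edge_set (V : finType) (G : sgraph V) (v w : V) :
  ([set v; w] \in edge_set G) = adj G v w.
Proof.
rewrite inE; apply/existsP/idP => [[v' /existsP[w' /andP[Gvw /eqP eq_vw]]]|Gvw];
  last by exists v; apply/existsP; exists w; rewrite Gvw eqxx.
have v'w' : v' != w' by apply: contraTneq Gvw => ->; rewrite adj_irrefl.
have /set2P[ev|ev] : v' \in [set v; w] by rewrite eq_vw set21.
  have /set2P[ew|ew] : w' \in [set v; w] by rewrite eq_vw set22.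
    by rewrite ev ew eqxx in v'w'.
  by rewrite -ev -ew.
have /set2P[ew|ew] : w' \in [set v; w] by rewrite eq_vw set22.
  by rewrite -ev -ew adj_sym.
by rewrite ev ew eqxx in v'w'.
Qed.

Lemma laplacian_entryC (V : finType) (S : signed_graph V) v w :
  laplacian_entry S v w = laplacian_entry S w v.
Proof. by rewrite /laplacian_entry setUC; case: eqVneq => // ->. Qed.

Lemma laplacian_entry_adj (V : finType) (S : signed_graph V) v w :
  adj (ugraph S) v w ->
  laplacian_entry S v w = 1 \/ laplacian_entry S v w = - 1.
Proof.
move=> Gvw; rewrite /laplacian_entry ifN; last first.
  by apply: contraTneq Gvw => ->; rewrite adj_irrefl.
case: insubP => [e _ _|]; last by rewrite mem_edge_set Gvw.
by case: sign_of; [right|left].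
Qed.

Lemma laplacian_entry_nonadj (V : finType) (S : signed_graph V) v w :
  v != w -> ~~ adj (ugraph S) v w -> laplacian_entry S v w = 0.
Proof.
by move=> /negPf vw nGvw; rewrite /laplacian_entry vw insubN // mem_edge_set.
Qed.

Lemma degree_fan n (i : 'I_n) :
  degree (fan n) (Some i) = (1 + (0 < i) + (i.+1 < n))%N.
Proof.
rewrite /degree -sum1dep_card big_mkcond (bigD1 None) //= -addnA; congr addn.
rewrite (reindex_omap Some id) => [|[]] //=.
under eq_bigl => j do rewrite eqxx.
(* The two path neighbours of i differ, so the disjunction is a sum. *)
have disj (j : nat) : ((i.+1 == j) || (j.+1 == i) : nat)
                     = ((j.+1 == i) + (j == i.+1))%N.
  by lia.
under eq_bigr => j _ do rewrite -[if _ then _ else _]/(nat_of_bool _) disj.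
rewrite big_split /= -!big_mkcond (big_ord1_eq _ (fun=> 1%N)); congr addn.
case: i {disj} => [[|i] lt_in] /=; first by rewrite big1.
by rewrite (big_ord1_eq _ (fun=> 1%N)) ltnW.
Qed.

(** The entry of [s] at k is the product of the signs of the first k path edges,
    so that [s k * s k.+1] is the sign of the edge between k and k + 1.  The
    normalization [s 0 = 1] makes the first basis vector a generator on which the
    functional below takes the value 1. *)
Lemma fan_switching n (phi : edge (fan n) -> sign) :
  exists s : nat -> int, [/\ s 0%N = 1, forall k, s k * s k = 1 &
    forall i j : 'I_n,
      reduced_laplacian (SignedGraph phi) i j = s i * s j * fan_laplacian n i j].
Proof.
case: n phi => [|n] phi; first by exists (fun=> 1); split=> // -[].
pose S := SignedGraph phi.
pose neg k := laplacian_entry S (Some (inord k)) (Some (inord k.+1)) == 1.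
pose s k : int := \prod_(l < k) (-1) ^+ neg l.
have s2 k : s k * s k = 1.
  by rewrite /s -big_split big1 //= => l _; rewrite -expr2 sqrr_sign.
have off (i j : 'I_n.+1) : i.+1 = j ->
    laplacian_entry S (Some i) (Some j) = - (s i * s j).
  move=> ij; rewrite -ij /s big_ord_recr /= -/(s i) mulrA s2 mul1r /neg ij.
  rewrite !inord_val.
  have Gij : adj (ugraph S) (Some i) (Some j) by rewrite /= ij eqxx.
  by have [->|->] := laplacian_entry_adj Gij.
exists s; split=> // [|i j]; first by rewrite /s big_ord0.
rewrite !mxE.
have [<-|ij] := eqVneq i j.
  rewrite s2 mul1r /laplacian_entry eqxx degree_fan mulr1n.
  by rewrite !gtn_eqF // !subr0.
have [eij|nij] := eqVneq i.+1 j.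
  have -> : (j.+1 == i) = false by lia.
  by rewrite off // mulr0n subr0 sub0r mulrN1.
have [eji|nji] := eqVneq j.+1 i.
  by rewrite laplacian_entryC off // mulr0n subr0 sub0r mulrN1 mulrC.
by rewrite laplacian_entry_nonadj ?mulr0n ?subr0 ?mulr0 //= negb_or nij nji.
Qed.

(** The solution starting from 1 of all column equations of the switched fan but
    the last. *)
Definition fan_functional n (s : nat -> int) : 'rV[int]_n :=
  \row_i (s i * (fib (2 * i).+1)%:Z).

Lemma additive_colE (U : zmodType) m (f : {additive 'cV[int]_m -> U}) v :
  f v = \sum_i f (delta_mx i 0) *~ v i 0.
Proof.
rewrite {1}[v]matrix_sum_delta raddf_sum; apply: eq_bigr => i _.
by rewrite big_ord1 -raddfMz -scaler_int intz.
Qed.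

Lemma fan_functional_column n (s : nat -> int) (L : 'M[int]_n) (j : 'I_n) :
  (forall k, s k * s k = 1) ->
  (forall i j : 'I_n, L i j = s i * s j * fan_laplacian n i j) ->
  (fan_functional n s *m L) 0 j =
    s j * (if j.+1 == n then (fib (2 * n))%:Z else 0).
Proof.
move=> s2 Ls; have := fan_laplacian_fib (1 : int) j; rewrite natz => <-.
rewrite mxE mulr_sumr; apply: eq_bigr => i _.
rewrite mxE Ls natz mulrzz -[RHS]mul1r -(s2 i); ring.
Qed.

(** The projection to [coker L] kills the columns of [L]; multiplying its values
    on the basis vectors by [s] gives a sequence killed by the columns of the
    all-positive fan, to which [fan_laplacian_kernel] applies. *)
Lemma fan_coker_cyclic n (s : nat -> int) (L : 'M[int]_n.+1) :
  s 0%N = 1 -> (forall k, s k * s k = 1) ->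
  (forall i j : 'I_n.+1, L i j = s i * s j * fan_laplacian n.+1 i j) ->
  let g : coker L := \pi_(coker L)%qT (delta_mx ord0 0) in
  (forall v, \pi_(coker L)%qT v = g *~ (fan_functional n.+1 s *m v) 0 0)
  /\ g *+ fib (2 * n.+1) = 0.
Proof.
move=> s0 s2 Ls g.
(* [inord] extends the basis to a sequence indexed by nat, as the column
   lemmas require. *)
pose e k : coker L := \pi_(coker L)%qT (delta_mx (inord k) 0).
pose y k := e k *~ s k.
have y_ker (j : 'I_n.+1) : \sum_(i < n.+1) y i *~ fan_laplacian n.+1 i j = 0.
  transitivity (\pi_(coker L)%qT (L *m delta_mx j 0) *~ s j).
    rewrite additive_colE mulrz_suml; apply: eq_bigr => i _.
    rewrite -colE [col j L _ _]mxE Ls /y /e inord_val -!mulrzA; congr (_ *~ _).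
    by rewrite -[LHS]mul1r -(s2 j); ring.
  suff -> : \pi_(coker L)%qT (L *m delta_mx j 0) = 0 by rewrite mul0rz.
  apply/eqP; rewrite -(raddf0 \pi_(coker L)%qT) -Quotient.idealrBE subr0.
  by apply/asboolP; exists (delta_mx j 0).
have y0 : y 0%N = g.
  rewrite /y s0 mulr1z /e (_ : inord 0 = ord0) //.
  by apply/val_inj; rewrite /= inordK.
have yE := fan_laplacian_kernel y_ker.
split=> [v|].
  rewrite additive_colE mxE mulrz_sumr; apply: eq_bigr => i _.
  rewrite mxE !mulrzA; congr (_ *~ _).
  rewrite mulrzA_C mulrzA -y0 -pmulrn -yE //.
  by rewrite /y -mulrzA s2 mulr1z /e inord_val.
rewrite -y0; have := fan_laplacian_fib (y 0%N) (@ord_max n); rewrite eqxx => <-.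
by rewrite -[RHS](y_ker ord_max); apply: eq_bigr => i _; rewrite -yE.
Qed.

Theorem theorem4p21 (n : nat) (n_ge1 : (1 <= n)%N)
    (phi : edge (fan n) -> sign) :
  zmod_isog (critical_group (SignedGraph phi)) (Zmod (fib (2 * n))).
Proof.
case: n n_ge1 phi => // n _ phi; have [s [s0 s2 Ls]] := fan_switching phi.
have [piE g_tors] := fan_coker_cyclic s0 s2 Ls.
rewrite /critical_group; set L := reduced_laplacian _ in Ls piE g_tors *.
pose a := fan_functional n.+1 s.
pose F (v : 'cV[int]_n.+1) : int := (a *m v) 0 0.
have F_add : zmod_morphism F by move=> u v; rewrite /F mulmxBr !mxE.
pose fM := GRing.isZmodMorphism.Build _ _ F F_add.
pose FA : {additive 'cV[int]_n.+1 -> int} := HB.pack F fM.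
apply: (@quot_isog _ _ _ _ FA (fun k => k *: delta_mx ord0 0)) => [k|v].
  by rewrite /FA /= /F -scalemxAr -colE !mxE s0 mul1r mulr1.
rewrite /FA /=; apply/idP/idP => [/dvdzP[q Fv]|/asboolP[x ->]].
  (* The class of v is F v times the generator, and F v is a multiple of the
     Fibonacci number that kills the generator. *)
  rewrite -[v]subr0 Quotient.idealrBE raddf0 piE -/a -/(F v) Fv.
  by rewrite mulrC mulrzA -pmulrn g_tors mul0rz.
rewrite /F mulmxA mxE rpred_sum // => j _.
rewrite (fan_functional_column _ s2 Ls); apply: dvdz_mulr; apply: dvdz_mull.
by case: ifP => _; rewrite ?dvdzz ?dvdz0.
Qed.
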